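(* Let $A>0$, $0<r_0<r_1$, $\rho_0>0$, $U_{10}>0$, $U_{20}\in\mathbb{R}$. Consider the problem of finding $(\rho,U_1,U_2)$ on $[r_0,r_1]$ with $$\frac{d}{dr}(\rho U_1)+\frac1r\rho U_1=0,\qquad \rho U_1U_1'-\frac{\rho U_2^2}{r}+A\rho'=0,\qquad U_1U_2'+\frac{U_1U_2}{r}=0,\qquad r_0<r<r_1,$$ $$\rho(r_0)=\rho_0,\qquad U_1(r_0)=U_{10},\qquad U_2(r_0)=U_{20}.$$ Then: (i) If $M_1^2(r_0)>1$, the problem has a unique supersonic smooth solution in $\Omega$. (ii) If $|\mathbf{M}|^2(r_0)<1$, the problem has a unique subsonic smooth solution in $\Omega$. (iii) If $|\mathbf{M}|^2(r_0)>1>M_1^2(r_0)$, then the constant $$r_s=\sqrt{\frac{m_1^2+m_2^2\rho_s^2}{2(B_0-A\ln\rho_s)\rho_s^2}},$$ which depends only on $r_0$ and the incoming flow, satisfies $r_s>r_0$, and (1) if $r_1>r_s$, there exists a unique smooth transonic solution in $\Omega$; (2) if $r_1<r_s$, there exists a unique smooth supersonic solution in $\Omega$; (3) if $r_1=r_s$, there exists a unique smooth supersonic-sonic solution in $\Omega$, with sonic circle located at $r=r_s$.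
   Context: The equations are those of radially symmetric steady isothermal Euler flow (pressure $p=A\rho$, sound speed $\sqrt{A}$) in the annulus $\Omega=\{(x_1,x_2): r_0<r=\sqrt{x_1^2+x_2^2}<r_1\}$; $\rho>0$ is the density, and $U_1$, $U_2$ are the radial and angular velocities, all functions of $r$. Mach numbers: $M_i^2=U_i^2/A$ for $i=1,2$, and $|\mathbf{M}|^2=M_1^2+M_2^2$. The flow is supersonic at $r$ if $|\mathbf{M}|^2(r)>1$, sonic if $|\mathbf{M}|^2(r)=1$, subsonic if $|\mathbf{M}|^2(r)<1$. A solution is supersonic (subsonic) in $\Omega$ if it is so at every $r\in(r_0,r_1)$; transonic if it has both a supersonic and a subsonic region in $\Omega$ (here changing across a sonic circle); supersonic-sonic if it is supersonic for $r_0<r<r_1$ and sonic at $r=r_1$. Constants: $m_1=r_0\rho_0U_{10}$, $m_2=r_0U_{20}$, $B_0=\frac12(U_{10}^2+U_{20}^2)+A\ln\rho_0$, $\rho_s=\exp\left(\frac{B_0}{A}-\frac12\right)$. *)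

(* Defs.v *)
From Stdlib Require Import Reals.
From Coquelicot Require Import Coquelicot.
Open Scope R_scope.

(* A radially symmetric flow, as functions of r; the values outside
   [r0, r1] play no role. *)
Record flow := Flow {
  density : R -> R;
  vrad : R -> R;   (* U_1 *)
  vang : R -> R    (* U_2 *)
}.

(* C^infinity on the closed interval [a, b]: derivatives of all orders exist
   in (a, b) and have finite one-sided limits at a and b, and f itself is
   continuous on [a, b]. *)
Definition smooth_on (a b : R) (f : R -> R) : Prop :=
  continuous_on (fun x => a <= x <= b) f /\
  forall n : nat,
    (forall x, a < x < b -> ex_derive_n f n x) /\
    (exists l : R, filterlim (Derive_n f n) (at_right a) (locally l)) /\
    (exists l : R, filterlim (Derive_n f n) (at_left b) (locally l)).

Definition smooth_solution (A r0 r1 rho0 U10 U20 : R) (w : flow) : Prop :=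
  let rho := density w in
  let U1 := vrad w in
  let U2 := vang w in
  (smooth_on r0 r1 rho /\ smooth_on r0 r1 U1 /\ smooth_on r0 r1 U2) /\
  (forall r, r0 <= r <= r1 -> 0 < rho r) /\
  (forall r, r0 < r < r1 ->
     Derive (fun s => rho s * U1 s) r + 1 / r * (rho r * U1 r) = 0 /\
     rho r * U1 r * Derive U1 r - rho r * U2 r ^ 2 / r + A * Derive rho r = 0 /\
     U1 r * Derive U2 r + U1 r * U2 r / r = 0) /\
  (rho r0 = rho0 /\ U1 r0 = U10 /\ U2 r0 = U20).

(* Square of the Mach number of the velocity component u (sound speed sqrt A). *)
Definition mach_sq (A u : R) : R := u ^ 2 / A.

Definition total_mach_sq (A : R) (w : flow) (r : R) : R :=
  mach_sq A (vrad w r) + mach_sq A (vang w r).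

Definition sonic_at (A : R) (w : flow) (r : R) : Prop :=
  total_mach_sq A w r = 1.

Definition supersonic (A a b : R) (w : flow) : Prop :=
  forall r, a < r < b -> 1 < total_mach_sq A w r.

Definition subsonic (A a b : R) (w : flow) : Prop :=
  forall r, a < r < b -> total_mach_sq A w r < 1.

(* One supersonic and one subsonic region, in either order, separated by a
   sonic circle. *)
Definition transonic (A a b : R) (w : flow) : Prop :=
  exists c, a < c < b /\ sonic_at A w c /\
    ((supersonic A a c w /\ subsonic A c b w) \/
     (subsonic A a c w /\ supersonic A c b w)).

Definition supersonic_sonic (A a b : R) (w : flow) : Prop :=
  supersonic A a b w /\ sonic_at A w b.

Definition same_flow (a b : R) (w w' : flow) : Prop :=
  forall r, a <= r <= b ->
    density w r = density w' r /\ vrad w r = vrad w' r /\ vang w r = vang w' r.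

Definition exists_unique_flow (a b : R) (P : flow -> Prop) : Prop :=
  exists w, P w /\ forall w', P w' -> same_flow a b w w'.

Definition m1 (r0 rho0 U10 : R) : R := r0 * rho0 * U10.

Definition m2 (r0 U20 : R) : R := r0 * U20.

Definition B0 (A rho0 U10 U20 : R) : R :=
  1 / 2 * (U10 ^ 2 + U20 ^ 2) + A * ln rho0.

Definition rho_s (A rho0 U10 U20 : R) : R :=
  exp (B0 A rho0 U10 U20 / A - 1 / 2).

Definition r_s (A r0 rho0 U10 U20 : R) : R :=
  let rs := rho_s A rho0 U10 U20 in
  sqrt ((m1 r0 rho0 U10 ^ 2 + m2 r0 U20 ^ 2 * rs ^ 2) /
        (2 * (B0 A rho0 U10 U20 - A * ln rs) * rs ^ 2)).

(* Main.v *)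
Require Import Defs.
From Stdlib Require Import Reals Lra Ranalysis5 ClassicalEpsilon.
From Coquelicot Require Import Coquelicot.
Open Scope R_scope.

(* The equations have the first integrals [r rho U1 = m1], [r U2 = m2] and
   Bernoulli's law, so they amount to the scalar equation
   [U1 ^ 2 / 2 - A ln U1 = C - m2 ^ 2 / (2 r ^ 2) + A ln r].
   Its left-hand side decreases on [U1 < sqrt A] and increases on
   [U1 > sqrt A], and its right-hand side increases with [r]; hence [U1] never
   reaches [sqrt A] and stays on its initial branch, on which the equation
   determines it as a smooth function of [r].  On the branch [U1 < sqrt A] the
   total speed strictly decreases with [r], so the Mach number at [r] is
   decided by comparing [r] with [r0] or with the sonic radius [r_s]. *)

(** * Strict monotonicity and differentiable inverses on an interval *)

Lemma pos_derive_increasing (f df : R -> R) (a b : R) :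
  (forall x, a <= x <= b -> is_derive f x (df x)) ->
  (forall x, a < x < b -> 0 < df x) ->
  forall x y, a <= x -> x < y -> y <= b -> f x < f y.
Proof.
  intros Hf Hpos x y Hx Hxy Hy.
  destruct (MVT_cor2 f df x y Hxy) as [c [Hc Hcxy]].
  - intros c Hc. apply is_derive_Reals, Hf; lra.
  - assert (0 < df c * (y - x)) by
      (apply Rmult_lt_0_compat; [apply Hpos|]; lra).
    lra.
Qed.

(** The sign of [df] is imposed only inside the interval because [radial_head] is critical at
    [sqrt A], an end of both its branches; accordingly [g] is differentiated only at interior
    values. *)
Lemma inverse_function (f df : R -> R) (a b : R) :
  a < b ->
  (forall x, a <= x <= b -> is_derive f x (df x)) ->
  (forall x, a < x < b -> 0 < df x) ->
  exists g : R -> R, forall y, f a < y < f b ->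
    a < g y < b /\ f (g y) = y /\ is_derive g y (/ df (g y)).
Proof.
  intros Hab Hf Hpos.
  pose proof (pos_derive_increasing f df a b Hf Hpos) as Hincr.
  assert (Hcont : forall x, a <= x <= b -> continuity_pt f x).
  { intros x Hx. apply continuity_pt_filterlim.
    apply (ex_derive_continuous f). exists (df x). now apply Hf. }
  (* The range condition sits under the existential, with [a] as default value outside the range, so
     that choice yields a total function. *)
  assert (Hex : forall y, exists x, f a <= y <= f b -> a <= x <= b /\ f x = y).
  { intros y. destruct (classic (f a <= y <= f b)) as [Hy|Hy].
    - destruct (f_interv_is_interv f a b y Hab Hy Hcont) as [x Hx].
      exists x. now intros _.
    - exists a. tauto. }
  set (g := fun y => proj1_sig (constructive_indefinite_description _ (Hex y))).
  assert (Hg : forall y, f a <= y <= f b -> a <= g y <= b /\ f (g y) = y).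
  { intros y. unfold g. apply proj2_sig. }
  assert (Hfab : f a < f b) by (apply Hincr; lra).
  assert (Hga : g (f a) = a).
  { destruct (Hg (f a)) as [H1 H2]; [lra|].
    destruct (Req_dec a (g (f a))) as [|Hne]; [easy|].
    pose proof (Hincr a (g (f a))). lra. }
  assert (Hgb : g (f b) = b).
  { destruct (Hg (f b)) as [H1 H2]; [lra|].
    destruct (Req_dec b (g (f b))) as [|Hne]; [easy|].
    pose proof (Hincr (g (f b)) b). lra. }
  exists g. intros y Hy.
  destruct (Hg y) as [Hgy Hfgy]; [lra|].
  assert (Hin : a < g y < b).
  { split; apply Rnot_le_lt; intros Hle.
    - replace (g y) with a in Hfgy by lra. lra.
    - replace (g y) with b in Hfgy by lra. lra. }
  split; [easy|]. split; [easy|].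
  assert (Hgc : continuity_pt g y).
  { apply (continuity_pt_recip_interv f g a b Hab Hincr); try easy.
    - intros z Hz1 Hz2. now apply Hg.
    - intros z Hz1 Hz2. now apply Hg. }
  assert (Prf : forall c, g (f a) <= c <= g (f b) -> derivable_pt f c).
  { intros c Hc. exists (df c). apply is_derive_Reals, Hf. lra. }
  assert (Prg : g (f a) <= g y <= g (f b)) by lra.
  assert (Hd : derive_pt f (g y) (Prf (g y) Prg) = df (g y)).
  { apply derive_pt_eq_0. apply is_derive_Reals, Hf. lra. }
  pose proof (Hpos (g y) Hin).
  apply is_derive_Reals.
  replace (/ df (g y)) with (1 / derive_pt f (g y) (Prf (g y) Prg))
    by (rewrite Hd; field; lra).
  apply derivable_pt_lim_recip_interv with (f a) (f b); try easy.
  - intros z Hz. now apply Hg.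
  - rewrite Hd. lra.
Qed.

(** * Functions of class C^k on an open interval *)

(** Derivatives are carried as witnesses, so that closure under algebraic operations is an induction
    on [k] with the usual rules; [Ck_Derive_n] returns to [Derive_n]. *)
Fixpoint Ck (k : nat) (a b : R) (f : R -> R) : Prop :=
  match k with
  | O => forall x, a < x < b -> continuous f x
  | S k => exists g, (forall x, a < x < b -> is_derive f x (g x)) /\ Ck k a b g
  end.

Lemma Ck_continuous (k : nat) (a b : R) (f : R -> R) :
  Ck k a b f -> forall x, a < x < b -> continuous f x.
Proof.
  destruct k as [|k]; [easy|].
  intros [g [Hg _]] x Hx. apply (ex_derive_continuous f). exists (g x). auto.
Qed.

Lemma Ck_pred (k : nat) (a b : R) (f : R -> R) : Ck (S k) a b f -> Ck k a b f.
Proof.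
  revert f. induction k as [|k IH]; intros f [g [Hg Hk]].
  - exact (Ck_continuous 1 a b f (ex_intro _ g (conj Hg Hk))).
  - exists g. auto.
Qed.

Lemma Ck_ext (k : nat) (a b : R) (f g : R -> R) :
  (forall x, f x = g x) -> Ck k a b f -> Ck k a b g.
Proof.
  intros Heq. destruct k as [|k].
  - intros Hf x Hx. apply (continuous_ext f); auto.
  - intros [df [Hdf Hk]]. exists df. split; [|easy].
    intros x Hx. apply (is_derive_ext f); auto.
Qed.

Lemma Ck_const (k : nat) (a b c : R) : Ck k a b (fun _ => c).
Proof.
  revert c. induction k as [|k IH]; intros c.
  - intros x _. apply continuous_const.
  - exists (fun _ => 0). split; [|apply IH]. intros x _. apply @is_derive_const.
Qed.

Lemma Ck_id (k : nat) (a b : R) : Ck k a b (fun x => x).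
Proof.
  destruct k as [|k].
  - intros x _. apply continuous_id.
  - exists (fun _ => 1). split; [|apply Ck_const]. intros x _. apply @is_derive_id.
Qed.

Lemma Ck_plus (k : nat) (a b : R) (f g : R -> R) :
  Ck k a b f -> Ck k a b g -> Ck k a b (fun x => f x + g x).
Proof.
  revert f g. induction k as [|k IH]; intros f g.
  - intros Hf Hg x Hx. apply (continuous_plus f g); auto.
  - intros [f' [Hf Hf']] [g' [Hg Hg']]. exists (fun x => f' x + g' x).
    split; [|auto]. intros x Hx. apply (is_derive_plus f g); auto.
Qed.

Lemma Ck_mult (k : nat) (a b : R) (f g : R -> R) :
  Ck k a b f -> Ck k a b g -> Ck k a b (fun x => f x * g x).
Proof.
  revert f g. induction k as [|k IH]; intros f g.
  - intros Hf Hg x Hx. apply (continuous_mult f g); auto.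
  - intros Hf Hg.
    pose proof (Ck_pred _ _ _ _ Hf) as Hfk. pose proof (Ck_pred _ _ _ _ Hg) as Hgk.
    destruct Hf as [f' [Hf Hf']], Hg as [g' [Hg Hg']].
    exists (fun x => f' x * g x + f x * g' x). split.
    + intros x Hx. apply (is_derive_mult f g); auto. exact Rmult_comm.
    + apply (Ck_plus k a b (fun x => f' x * g x) (fun x => f x * g' x)); auto.
Qed.

Lemma Ck_inv (k : nat) (a b : R) (f : R -> R) :
  (forall x, a < x < b -> f x <> 0) -> Ck k a b f -> Ck k a b (fun x => / f x).
Proof.
  intros Hne. induction k as [|k IH].
  - intros Hf x Hx. apply continuous_Rinv_comp; auto.
  - intros Hf. pose proof (Ck_pred _ _ _ _ Hf) as Hfk.
    destruct Hf as [f' [Hf Hf']].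
    (* In this form the derivative is a product of [f'] and two copies of [/ f], to which the
       induction hypothesis applies. *)
    exists (fun x => (-1 * f' x) * (/ f x * / f x)). split.
    + intros x Hx.
      replace (-1 * f' x * (/ f x * / f x)) with (- f' x / f x ^ 2)
        by (field; auto).
      apply is_derive_inv; auto.
    + apply (Ck_mult k a b (fun x => -1 * f' x)).
      * apply (Ck_mult k a b (fun _ => -1) f'); [apply Ck_const | easy].
      * apply (Ck_mult k a b (fun x => / f x) (fun x => / f x)); auto.
Qed.

(** The spare order [k] carries the induction: the hypothesis is used with [S k], and one order is
    spent on the next derivative. *)
Lemma Ck_Derive_n (a b : R) (f : R -> R) (n k : nat) :
  Ck (n + k) a b f ->
  exists g, Ck k a b g /\
    forall x, a < x < b -> ex_derive_n f n x /\ Derive_n f n x = g x.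
Proof.
  revert k. induction n as [|n IH]; intros k Hf.
  - exists f. now split.
  - replace (S n + k)%nat with (n + S k)%nat in Hf
      by (simpl; now rewrite <- plus_n_Sm).
    destruct (IH (S k) Hf) as [g [[g' [Hg Hg']] Hn]].
    exists g'. split; [easy|]. intros x Hx.
    assert (Hd : is_derive (Derive_n f n) x (g' x)).
    { apply (is_derive_ext_loc g); [|auto].
      apply (filter_imp (fun y => a < y < b)).
      - intros y Hy. symmetry. now apply Hn.
      - apply filter_and; [now apply (open_gt a) | now apply (open_lt b)]. }
    split.
    + exists (g' x). exact Hd.
    + simpl. now apply is_derive_unique.
Qed.

(** Since [a] and [b] are interior to the larger interval, the one-sided limits there are
    restrictions of two-sided ones. *)
Lemma Ck_smooth_on (a' b' a b : R) (f : R -> R) :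
  a' < a -> a < b -> b < b' -> (forall k, Ck k a' b' f) -> smooth_on a b f.
Proof.
  intros Ha Hab Hb Hf. split.
  - apply continuous_on_forall. intros x Hx. apply (Ck_continuous 0 a' b'); [auto|lra].
  - intros n. destruct (Ck_Derive_n a' b' f n 0) as [g [Hg Hn]]; [apply Hf|].
    assert (Hlim : forall x, a' < x < b' ->
              filterlim (Derive_n f n) (locally x) (locally (g x))).
    { intros x Hx. apply (filterlim_ext_loc g); [|now apply Hg].
      apply (filter_imp (fun y => a' < y < b')).
      - intros y Hy. symmetry. now apply Hn.
      - apply filter_and; [now apply (open_gt a') | now apply (open_lt b')]. }
    repeat split.
    + intros x Hx. apply Hn. lra.
    + exists (g a). apply (@filterlim_filter_le_1 _ _ (locally a)).
      * apply filter_le_within.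
      * apply Hlim. lra.
    + exists (g b). apply (@filterlim_filter_le_1 _ _ (locally b)).
      * apply filter_le_within.
      * apply Hlim. lra.
Qed.

(** * Passing from the open to the closed interval *)

Lemma zero_derive_const (a b : R) (f : R -> R) :
  (forall x, continuous f x) ->
  (forall x, a < x < b -> is_derive f x 0) ->
  forall x, a <= x <= b -> f x = f a.
Proof.
  intros Hc Hd x Hx.
  destruct (MVT_gen f a x (fun _ => 0)) as [c [_ Heq]].
  - intros y. rewrite Rmin_left, Rmax_right by lra. intros Hy. apply Hd. lra.
  - intros y _. apply continuity_pt_filterlim, Hc.
  - lra.
Qed.

(* Composing with [clamp] turns continuity on [[a, b]], one-sided at the end
   points, into the two-sided continuity required by [MVT_gen] and [IVT_gen]. *)
Definition clamp (a b x : R) : R := Rmax a (Rmin b x).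

Lemma clamp_in (a b x : R) : a <= b -> a <= clamp a b x <= b.
Proof.
  intros Hab. unfold clamp, Rmax, Rmin.
  destruct (Rle_dec b x); destruct (Rle_dec a _); lra.
Qed.

Lemma clamp_id (a b x : R) : a <= x <= b -> clamp a b x = x.
Proof. intros Hx. unfold clamp. rewrite Rmin_right, Rmax_right; lra. Qed.

Lemma continuous_clamp (a b x : R) : continuous (clamp a b) x.
Proof.
  (* The clamp is 1-Lipschitz, so [eps] itself serves as the radius. *)
  apply continuity_pt_filterlim. intros eps Heps. exists eps. split; [easy|].
  intros y [_ Hy]. apply Rle_lt_trans with (2 := Hy).
  simpl. unfold R_dist, clamp, Rmax, Rmin.
  destruct (Rle_dec b x), (Rle_dec b y);
    repeat (destruct (Rle_dec a _)); unfold Rabs; repeat destruct Rcase_abs; lra.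
Qed.

Lemma continuous_on_clamp (a b : R) (f : R -> R) :
  a <= b -> continuous_on (fun x => a <= x <= b) f ->
  forall x, continuous (fun y => f (clamp a b y)) x.
Proof.
  intros Hab Hf x.
  apply (filterlim_comp _ _ _ (clamp a b) f (locally x)
           (within (fun y => a <= y <= b) (locally (clamp a b x)))).
  - intros P HP. change (locally x (fun y => P (clamp a b y))).
    apply (filter_imp (fun y => a <= clamp a b y <= b -> P (clamp a b y))).
    + intros y Hy. apply Hy. now apply clamp_in.
    + exact (continuous_clamp a b x _ HP).
  - apply Hf. now apply clamp_in.
Qed.

Lemma is_derive_clamp (a b : R) (f : R -> R) (x l : R) :
  a < x < b -> is_derive f x l -> is_derive (fun y => f (clamp a b y)) x l.
Proof.
  intros Hx. apply is_derive_ext_loc.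
  apply (filter_imp (fun y => a < y < b)).
  - intros y Hy. rewrite clamp_id; [easy | lra].
  - apply filter_and; [now apply (open_gt a) | now apply (open_lt b)].
Qed.

(** * The scalar equation for the radial speed *)

(** The part of Bernoulli's law that contains [U1] once the density is replaced by [m1 / (r * U1)];
    the part in [r] alone is [head_level]. *)
Definition radial_head (A u : R) : R := u ^ 2 / 2 - A * ln u.

Definition head_level (A C m r : R) : R := C - m ^ 2 / (2 * r ^ 2) + A * ln r.

Lemma is_derive_radial_head (A u : R) :
  0 < u -> is_derive (radial_head A) u (u - A / u).
Proof. intros Hu. unfold radial_head. auto_derive; [easy|]. field. lra. Qed.

Lemma is_derive_head_level (A C m r : R) :
  0 < r -> is_derive (head_level A C m) r (m ^ 2 / r ^ 3 + A / r).
Proof.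
  intros Hr. unfold head_level. auto_derive.
  - split; [|split]; [nra | easy | easy].
  - field. lra.
Qed.

(** The derivative is [(x ^ 2 - A) / x], whose sign matters only strictly between [u] and [v]; hence
    [u = sqrt A] is allowed, as [radial_head_min] requires. *)
Lemma radial_head_increasing (A u v : R) :
  0 < A -> 0 < u -> A <= u ^ 2 -> u < v -> radial_head A u < radial_head A v.
Proof.
  intros HA Hu HAu Huv.
  apply (pos_derive_increasing (radial_head A) (fun x => x - A / x) u v); try lra.
  - intros x Hx. apply is_derive_radial_head. lra.
  - intros x Hx. replace (x - A / x) with ((x ^ 2 - A) / x) by (field; lra).
    apply Rdiv_lt_0_compat; nra.
Qed.

Lemma radial_head_decreasing (A u v : R) :
  0 < A -> 0 < u -> v ^ 2 <= A -> u < v -> radial_head A v < radial_head A u.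
Proof.
  intros HA Hu HAv Huv. apply Ropp_lt_cancel.
  apply (pos_derive_increasing (fun x => - radial_head A x)
           (fun x => - (x - A / x)) u v); try lra.
  - intros x Hx. apply (is_derive_opp (radial_head A)), is_derive_radial_head. lra.
  - intros x Hx. replace (- (x - A / x)) with ((A - x ^ 2) / x) by (field; lra).
    apply Rdiv_lt_0_compat; nra.
Qed.

Lemma radial_head_min (A u : R) :
  0 < A -> 0 < u -> u ^ 2 <> A -> radial_head A (sqrt A) < radial_head A u.
Proof.
  intros HA Hu Hne. pose proof (sqrt_lt_R0 A HA) as Hs.
  pose proof (pow2_sqrt A (Rlt_le _ _ HA)) as Hs2.
  destruct (Rtotal_order u (sqrt A)) as [Hlt|[Heq|Hgt]].
  - apply radial_head_decreasing; lra.
  - rewrite Heq in Hne. lra.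
  - apply radial_head_increasing; lra.
Qed.

(* The sign [s] selects the branch: [s = 1] is radially supersonic
   ([u ^ 2 > A]), [s = -1] radially subsonic. *)
Lemma radial_head_inj (A s u v : R) :
  0 < A -> s = 1 \/ s = -1 -> 0 < u -> 0 < v ->
  0 < s * (u ^ 2 - A) -> 0 < s * (v ^ 2 - A) ->
  radial_head A u = radial_head A v -> u = v.
Proof.
  intros HA Hs Hu Hv Hsu Hsv Heq.
  destruct (Rtotal_order u v) as [Hlt|[|Hgt]]; [|easy|]; exfalso.
  - destruct Hs; subst s.
    + pose proof (radial_head_increasing A u v). lra.
    + pose proof (radial_head_decreasing A u v). lra.
  - destruct Hs; subst s.
    + pose proof (radial_head_increasing A v u). lra.
    + pose proof (radial_head_decreasing A v u). lra.
Qed.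

(** The bound [M] reduces each branch to a compact interval: the head tends to infinity both at 0
    and at infinity, so some far end point has a value above [M]. *)
Lemma radial_head_inverse (A s M : R) :
  0 < A -> s = 1 \/ s = -1 ->
  exists G, forall y, radial_head A (sqrt A) < y < M ->
    0 < G y /\ 0 < s * (G y ^ 2 - A) /\ radial_head A (G y) = y /\
    is_derive G y (/ (G y - A / G y)).
Proof.
  intros HA Hs. pose proof (sqrt_lt_R0 A HA) as Hc.
  pose proof (pow2_sqrt A (Rlt_le _ _ HA)) as Hc2.
  set (c := sqrt A) in *.
  destruct Hs; subst s.
  (* Here [h > 2] and [h / 2 - A > 1 + Rabs M]; by [ln h < h] the head at [h] exceeds
     [h * (h / 2 - A)], hence [M]. The summand [c] puts [h] beyond [sqrt A]. *)
  - set (h := 2 * A + 2 + 2 * Rabs M + c).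
    pose proof (Rabs_pos M) as HM0. pose proof (Rle_abs M) as HM.
    assert (Hh : 2 * A + 2 + 2 * Rabs M < h) by (unfold h; lra).
    assert (HhM : M < radial_head A h).
    { assert (Hln : ln h < h) by (rewrite <- (ln_exp h) at 2; apply ln_increasing;
        [lra | pose proof (exp_ineq1 h); lra]).
      unfold radial_head. nra. }
    destruct (inverse_function (radial_head A) (fun x => x - A / x) c h)
      as [G HG].
    + unfold h. lra.
    + intros x Hx. apply is_derive_radial_head. lra.
    + intros x Hx. replace (x - A / x) with ((x ^ 2 - A) / x) by (field; lra).
      apply Rdiv_lt_0_compat; nra.
    + exists G. intros y Hy. destruct (HG y) as [H1 [H2 H3]]; [lra|].
      split; [lra|]. split; [nra|]. now split.
  (* At [exp (- M / A)] the term [- A * ln] equals [M], and it grows towards 0. Halving the minimum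
     makes both inequalities strict. *)
  - set (l := Rmin c (exp (- M / A)) / 2).
    assert (Hl : 0 < l < c /\ l < exp (- M / A)).
    { pose proof (exp_pos (- M / A)). unfold l, Rmin.
      destruct (Rle_dec c (exp (- M / A))); lra. }
    assert (HlM : M < radial_head A l).
    { assert (Hln : ln l < - M / A) by
        (rewrite <- (ln_exp (- M / A)); apply ln_increasing; lra).
      apply (Rmult_lt_compat_l A) in Hln; [|easy].
      replace (A * (- M / A)) with (- M) in Hln by (field; lra).
      unfold radial_head. nra. }
    (* The head decreases on this branch, so its opposite is inverted and the inverse is composed
       with negation. *)
    destruct (inverse_function (fun x => - radial_head A x)
                (fun x => - (x - A / x)) l c) as [G HG].
    + lra.
    + intros x Hx. apply (is_derive_opp (radial_head A)), is_derive_radial_head. lra.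
    + intros x Hx. replace (- (x - A / x)) with ((A - x ^ 2) / x) by (field; lra).
      apply Rdiv_lt_0_compat; nra.
    + exists (fun y => G (- y)). intros y Hy.
      destruct (HG (- y)) as [H1 [H2 H3]]; [lra|].
      split; [lra|]. split; [nra|]. split; [lra|].
      replace (/ (G (- y) - A / G (- y)))
        with (-1 * / - (G (- y) - A / G (- y))).
      * apply (is_derive_comp G Ropp y); [easy|].
        auto_derive; [easy | ring].
      * field. repeat split; nra.
Qed.

Lemma head_level_increasing (A C m r t : R) :
  0 < A -> 0 < r -> r < t -> head_level A C m r < head_level A C m t.
Proof.
  intros HA Hr Hrt.
  apply (pos_derive_increasing (head_level A C m)
           (fun x => m ^ 2 / x ^ 3 + A / x) r t); try lra.
  - intros x Hx. apply is_derive_head_level. lra.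
  - intros x Hx. apply Rplus_le_lt_0_compat.
    + apply Rdiv_le_0_compat; [apply pow2_ge_0 | apply pow_lt; lra].
    + apply Rdiv_lt_0_compat; lra.
Qed.

(** The level rises with the radius, so on the decreasing branch of [radial_head] the radial speed
    falls, while [(m / r) ^ 2] does not grow. *)
Lemma speed_decreasing (A C m r t u v : R) :
  0 < A -> 0 < r -> r < t -> 0 < u -> 0 < v -> u ^ 2 < A -> v ^ 2 < A ->
  radial_head A u = head_level A C m r -> radial_head A v = head_level A C m t ->
  v ^ 2 + (m / t) ^ 2 < u ^ 2 + (m / r) ^ 2.
Proof.
  intros HA Hr Hrt Hu Hv HuA HvA Hur Hvt.
  pose proof (head_level_increasing A C m r t HA Hr Hrt) as Hlev.
  assert (Hvu : v < u).
  { destruct (Rtotal_order u v) as [Hlt|[Heq|Hgt]]; [| |easy].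
    - pose proof (radial_head_decreasing A u v). nra.
    - subst v. lra. }
  assert (Hang : (m / t) ^ 2 <= (m / r) ^ 2).
  { unfold Rdiv. rewrite !Rpow_mult_distr.
    apply Rmult_le_compat_l; [apply pow2_ge_0|].
    apply pow_incr. split.
    - apply Rlt_le, Rinv_0_lt_compat. lra.
    - apply Rinv_le_contravar; lra. }
  nra.
Qed.

(** * First integrals and uniqueness of smooth solutions *)

Definition flow_const (A r0 rho0 U10 U20 : R) : R :=
  B0 A rho0 U10 U20 - A * ln (m1 r0 rho0 U10).

Lemma initial_head (A r0 rho0 U10 U20 : R) :
  0 < r0 -> 0 < rho0 -> 0 < U10 ->
  radial_head A U10 =
  head_level A (flow_const A r0 rho0 U10 U20) (m2 r0 U20) r0.
Proof.
  intros Hr Hrho HU.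
  unfold radial_head, head_level, flow_const, B0, m1, m2.
  rewrite !ln_mult by (repeat apply Rmult_lt_0_compat; lra).
  field. lra.
Qed.

(** Up to nonvanishing factors, the equations say that these expressions have zero derivative inside
    the annulus; continuity up to the boundary circles carries the initial values to every [r]. *)
Lemma first_integrals (A r0 r1 rho0 U10 U20 : R) (w : flow) :
  0 < A -> 0 < r0 -> r0 < r1 -> 0 < rho0 -> 0 < U10 ->
  smooth_solution A r0 r1 rho0 U10 U20 w ->
  forall r, r0 <= r <= r1 ->
    r * density w r * vrad w r = m1 r0 rho0 U10 /\
    r * vang w r = m2 r0 U20 /\
    1 / 2 * (vrad w r ^ 2 + vang w r ^ 2) + A * ln (density w r)
      = B0 A rho0 U10 U20.
Proof.
  intros HA Hr0 Hr01 Hrho0 HU10 [[Srho [Su Sv]] [Hpos [Hode [I1 [I2 I3]]]]].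
  destruct w as [rho u v]. cbn [density vrad vang] in *.
  assert (Hcl : forall f, smooth_on r0 r1 f ->
            forall x, continuous (fun y => f (clamp r0 r1 y)) x).
  { intros f [Hf _]. apply continuous_on_clamp; [lra | easy]. }
  assert (Hder : forall f, smooth_on r0 r1 f ->
            forall x, r0 < x < r1 -> is_derive f x (Derive f x)).
  { intros f [_ Hf] x Hx. apply Derive_correct. exact (proj1 (Hf 1%nat) x Hx). }
  assert (Hid : forall x, continuous (clamp r0 r1) x)
    by (intros x; apply continuous_clamp).
  assert (Hend : forall f, (forall x, continuous (fun y => f (clamp r0 r1 y)) x) ->
            (forall x, r0 < x < r1 -> is_derive f x 0) ->
            forall x, r0 <= x <= r1 -> f x = f r0).
  { intros f Hf Hdf x Hx.
    assert (Hz := zero_derive_const r0 r1 _ Hf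
              (fun z Hz => is_derive_clamp r0 r1 f z 0 Hz (Hdf z Hz)) x Hx).
    simpl in Hz. now rewrite !clamp_id in Hz by lra. }
  assert (Hmass : forall r, r0 <= r <= r1 -> r * rho r * u r = r0 * rho r0 * u r0).
  { apply (Hend (fun r => r * rho r * u r)).
    - intros x. apply (continuous_mult (fun y => clamp r0 r1 y * rho (clamp r0 r1 y))).
      + apply (continuous_mult (clamp r0 r1)); auto.
      + auto.
    - intros x Hx. destruct (Hode x Hx) as [E1 _].
      rewrite (Derive_mult rho u) in E1 by
        (eexists; apply Hder; eauto).
      replace 0 with ((1 * rho x + x * Derive rho x) * u x
                      + (x * rho x) * Derive u x).
      + apply (is_derive_mult (fun y => y * rho y) u); auto using Rmult_comm.
        apply (is_derive_mult (fun y => y) rho); auto using Rmult_comm.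
        apply @is_derive_id.
      + replace 0 with (x * 0) by ring. rewrite <- E1. field. lra. }
  (* The mass flux is a positive constant, so [u] cannot vanish and may be divided out of the
     angular equation. *)
  assert (Hu : forall r, r0 <= r <= r1 -> 0 < u r).
  { intros r Hr. specialize (Hmass r Hr). specialize (Hpos r Hr).
    rewrite I1, I2 in Hmass.
    assert (0 < r0 * rho0 * U10) by (repeat apply Rmult_lt_0_compat; lra).
    assert (0 < r * rho r) by (apply Rmult_lt_0_compat; lra).
    apply (Rmult_lt_reg_l (r * rho r)); lra. }
  assert (Hang : forall r, r0 <= r <= r1 -> r * v r = r0 * v r0).
  { apply (Hend (fun r => r * v r)).
    - intros x. apply (continuous_mult (clamp r0 r1)); auto.
    - intros x Hx. destruct (Hode x Hx) as [_ [_ E3]].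
      assert (0 < u x) by (apply Hu; lra).
      replace 0 with (1 * v x + x * Derive v x).
      + apply (is_derive_mult (fun y => y) v); auto using Rmult_comm.
        apply @is_derive_id.
      + apply (Rmult_eq_reg_l (u x / x)).
        * rewrite Rmult_0_r, <- E3. field. lra.
        * apply Rgt_not_eq, Rdiv_lt_0_compat; lra. }
  assert (Hbern : forall r, r0 <= r <= r1 ->
    1 / 2 * (u r ^ 2 + v r ^ 2) + A * ln (rho r)
    = 1 / 2 * (u r0 ^ 2 + v r0 ^ 2) + A * ln (rho r0)).
  { apply (Hend (fun r => 1 / 2 * (u r ^ 2 + v r ^ 2) + A * ln (rho r))).
    - intros x.
      assert (Hsq : forall f, smooth_on r0 r1 f ->
                continuous (fun y => f (clamp r0 r1 y) ^ 2) x).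
      { intros f Hf. apply (continuous_comp (fun y => f (clamp r0 r1 y)) (fun z => z ^ 2)).
        - now apply Hcl.
        - apply (ex_derive_continuous (fun z => z ^ 2)). auto_derive. easy. }
      apply (continuous_plus (fun y => 1 / 2 * (u _ ^ 2 + v _ ^ 2))).
      + apply (continuous_mult (fun _ => 1 / 2)); [apply continuous_const|].
        apply (continuous_plus (fun y => u _ ^ 2)); auto.
      + apply (continuous_mult (fun _ => A)); [apply continuous_const|].
        apply (continuous_comp (fun y => rho (clamp r0 r1 y)) ln); [auto|].
        apply (ex_derive_continuous ln). auto_derive. apply Hpos, clamp_in. lra.
    - intros x Hx. destruct (Hode x Hx) as [_ [E2 E3]].
      assert (Hux : 0 < u x) by (apply Hu; lra).
      assert (Hrx : 0 < rho x) by (apply Hpos; lra).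
      assert (Hdv : Derive v x = - v x / x).
      { apply (Rmult_eq_reg_l (u x)); [|lra].
        replace (u x * (- v x / x)) with (- (u x * v x / x)) by (field; lra). lra. }
      auto_derive.
      + repeat split; try (eexists; apply Hder; easy). easy.
      + change (Derive (fun y => u y) x) with (Derive u x).
        change (Derive (fun y => v y) x) with (Derive v x).
        change (Derive (fun y => rho y) x) with (Derive rho x).
        rewrite Hdv.
        (* After substitution of [Derive v x], this is the radial momentum equation divided by
           [rho x]. *)
        replace 0 with (0 / rho x) by (field; lra). rewrite <- E2. field. lra. }
  intros r Hr. unfold m1, m2, B0.
  rewrite (Hmass r Hr), (Hang r Hr), (Hbern r Hr), I1, I2, I3. auto.
Qed.

(** Leaving the branch would, by the intermediate value theorem, give a radius where [U1 = sqrt A];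
    there the head is minimal, but the level is above the minimum from [r0] on. *)
Lemma smooth_solution_branch (A r0 r1 rho0 U10 U20 s : R) (w : flow) :
  0 < A -> 0 < r0 -> r0 < r1 -> 0 < rho0 -> 0 < U10 ->
  s = 1 \/ s = -1 -> 0 < s * (U10 ^ 2 - A) ->
  smooth_solution A r0 r1 rho0 U10 U20 w ->
  forall r, r0 <= r <= r1 ->
    0 < vrad w r /\ 0 < s * (vrad w r ^ 2 - A) /\
    radial_head A (vrad w r) =
      head_level A (flow_const A r0 rho0 U10 U20) (m2 r0 U20) r.
Proof.
  intros HA Hr0 Hr01 Hrho0 HU10 Hs HsU Hw.
  pose proof (first_integrals A r0 r1 rho0 U10 U20 w HA Hr0 Hr01 Hrho0 HU10 Hw) as Hint.
  destruct Hw as [[_ [[Su _] _]] [Hpos [_ [_ [I2 _]]]]].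
  assert (HU : U10 ^ 2 <> A) by (intros Heq; rewrite Heq in HsU; lra).
  pose proof (initial_head A r0 rho0 U10 U20 Hr0 Hrho0 HU10) as Hinit.
  pose proof (radial_head_min A U10 HA HU10 HU) as Hmin.
  set (C := flow_const A r0 rho0 U10 U20) in *.
  set (m := m2 r0 U20) in *.
  assert (Hm1 : 0 < m1 r0 rho0 U10)
    by (unfold m1; repeat apply Rmult_lt_0_compat; lra).
  assert (Hbase : forall r, r0 <= r <= r1 ->
            0 < vrad w r /\ radial_head A (vrad w r) = head_level A C m r).
  { intros r Hr. destruct (Hint r Hr) as [E1 [E2 E3]]. specialize (Hpos r Hr).
    assert (Hrr : 0 < r * density w r) by (apply Rmult_lt_0_compat; lra).
    assert (Hu : 0 < vrad w r) by (apply (Rmult_lt_reg_l (r * density w r)); lra).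
    split; [easy|].
    unfold radial_head, head_level, C, flow_const.
    rewrite <- E3, <- E2, <- E1, !ln_mult by lra. field. lra. }
  assert (Hlev : forall r, r0 <= r -> radial_head A (sqrt A) < head_level A C m r).
  { intros r [Hr|Hr].
    - pose proof (head_level_increasing A C m r0 r HA Hr0 Hr). lra.
    - rewrite <- Hr. lra. }
  intros r Hr. destruct (Hbase r Hr) as [Hu HF].
  split; [easy|]. split; [|easy].
  apply Rnot_le_lt. intros Hle.
  set (f := fun y => vrad w (clamp r0 r1 y)).
  assert (Hsq : 0 < sqrt A /\ sqrt A ^ 2 = A)
    by (split; [now apply sqrt_lt_R0 | apply pow2_sqrt; lra]).
  destruct (IVT_gen f r0 r (sqrt A)) as [c [Hc Hfc]].
  - intros x. apply continuity_pt_filterlim.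
    apply (continuous_on_clamp r0 r1 (vrad w)); [lra | easy].
  (* [U10] lies strictly on one side of [sqrt A], the supposed value at [r] on the other side or at
     [sqrt A]; [s] decides which is larger. *)
  - unfold f. rewrite !clamp_id, I2 by lra. unfold Rmin, Rmax.
    destruct Hs; subst s; destruct (Rle_dec U10 (vrad w r)); nra.
  - rewrite Rmin_left, Rmax_right in Hc by lra.
    unfold f in Hfc. rewrite clamp_id in Hfc by lra.
    destruct (Hbase c) as [_ HFc]; [lra|]. rewrite Hfc in HFc.
    pose proof (Hlev c). lra.
Qed.

(** Injectivity of the head on the branch fixes [U1]; mass flux and angular momentum then fix the
    density and [U2]. *)
Lemma smooth_solution_unique (A r0 r1 rho0 U10 U20 : R) (w w' : flow) :
  0 < A -> 0 < r0 -> r0 < r1 -> 0 < rho0 -> 0 < U10 -> U10 ^ 2 <> A ->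
  smooth_solution A r0 r1 rho0 U10 U20 w ->
  smooth_solution A r0 r1 rho0 U10 U20 w' ->
  same_flow r0 r1 w w'.
Proof.
  intros HA Hr0 Hr01 Hrho0 HU10 HU Hw Hw' r Hr.
  assert (Hs : exists s, (s = 1 \/ s = -1) /\ 0 < s * (U10 ^ 2 - A)).
  { destruct (Rlt_dec A (U10 ^ 2)); [exists 1 | exists (-1)]; split; auto; lra. }
  destruct Hs as [s [Hs HsU]].
  destruct (smooth_solution_branch A r0 r1 rho0 U10 U20 s w) with (r := r)
    as [Hu [Hsu HF]]; try easy.
  destruct (smooth_solution_branch A r0 r1 rho0 U10 U20 s w') with (r := r)
    as [Hu' [Hsu' HF']]; try easy.
  destruct (first_integrals A r0 r1 rho0 U10 U20 w) with (r := r)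
    as [E1 [E2 _]]; try easy.
  destruct (first_integrals A r0 r1 rho0 U10 U20 w') with (r := r)
    as [E1' [E2' _]]; try easy.
  assert (Huu : vrad w r = vrad w' r)
    by (apply (radial_head_inj A s); try easy; congruence).
  split; [|split; [easy|]].
  - rewrite <- E1', <- Huu in E1.
    apply Rmult_eq_reg_r in E1; [|lra].
    apply Rmult_eq_reg_l in E1; lra.
  - rewrite <- E2' in E2. apply Rmult_eq_reg_l in E2; lra.
Qed.

(** * Construction of the smooth solution *)

(* Bootstrap: the derivative of [u] is a rational expression in [u] and [x]. *)
Lemma radial_speed_Ck (A C m a b : R) (u : R -> R) :
  0 < a ->
  (forall x, a < x < b -> 0 < u x /\ u x ^ 2 <> A /\
     is_derive u x ((m ^ 2 / x ^ 3 + A / x) / (u x - A / u x))) ->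
  forall k, Ck k a b u.
Proof.
  intros Ha Hu.
  assert (Hden : forall x, a < x < b -> u x - A / u x <> 0).
  { intros x Hx. destruct (Hu x Hx) as [H1 [H2 _]].
    replace (u x - A / u x) with ((u x ^ 2 - A) / u x) by (field; lra).
    apply Rmult_integral_contrapositive_currified;
      [lra | apply Rinv_neq_0_compat; lra]. }
  assert (Hinv : forall k, Ck k a b (fun x => / x))
    by (intros k; apply (Ck_inv k a b (fun x => x)); [intros; lra | apply Ck_id]).
  assert (Hc : forall k c f, Ck k a b f -> Ck k a b (fun x => c * f x))
    by (intros k c f Hf; apply (Ck_mult k a b (fun _ => c)); [apply Ck_const | easy]).
  induction k as [|k IH].
  - intros x Hx. apply (ex_derive_continuous u). eexists. now apply Hu.
  - exists (fun x => (m ^ 2 / x ^ 3 + A / x) / (u x - A / u x)). split.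
    + intros x Hx. now apply Hu.
    (* The quotient is rewritten with sums, products and inverses, the shapes covered by the closure
       lemmas for [Ck]. *)
    + apply (Ck_ext k a b (fun x =>
        (m ^ 2 * (/ x * (/ x * / x)) + A * / x) * / (u x + - A * / u x))).
      * intros x. replace (u x + - A * / u x) with (u x - A / u x)
          by (unfold Rdiv; ring).
        replace (/ x * (/ x * / x)) with (/ x ^ 3)
          by (simpl; rewrite !Rinv_mult, Rinv_1; ring).
        reflexivity.
      * apply (Ck_mult k a b (fun x => _ + _) (fun x => / _)).
        -- apply (Ck_plus k a b (fun x => _ * _) (fun x => _ * _)).
           ++ apply Hc.
              apply (Ck_mult k a b (fun x => / x) (fun x => _ * _)); [easy|].
              apply (Ck_mult k a b (fun x => / x) (fun x => / x)); easy.
           ++ apply Hc. easy.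
        -- apply (Ck_inv k a b (fun x => u x + - A * / u x)).
           ++ intros x Hx. replace (u x + - A * / u x) with (u x - A / u x)
                by (unfold Rdiv; ring). auto.
           ++ apply (Ck_plus k a b u (fun x => _ * _)); [easy|].
              apply Hc, (Ck_inv k a b u); [|easy].
              intros x Hx. destruct (Hu x Hx). lra.
Qed.

(** The scalar equation is solved pointwise by the inverse of the head on the branch of [U10], on an
    open interval around [[r0, r1]] so that [Ck_smooth_on] applies. *)
Lemma smooth_solution_exists (A r0 r1 rho0 U10 U20 : R) :
  0 < A -> 0 < r0 -> r0 < r1 -> 0 < rho0 -> 0 < U10 -> U10 ^ 2 <> A ->
  exists w, smooth_solution A r0 r1 rho0 U10 U20 w.
Proof.
  intros HA Hr0 Hr01 Hrho0 HU10 HU.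
  assert (Hs : exists s, (s = 1 \/ s = -1) /\ 0 < s * (U10 ^ 2 - A)).
  { destruct (Rlt_dec A (U10 ^ 2)); [exists 1 | exists (-1)]; split; auto; lra. }
  destruct Hs as [s [Hs HsU]].
  pose proof (initial_head A r0 rho0 U10 U20 Hr0 Hrho0 HU10) as Hinit.
  pose proof (radial_head_min A U10 HA HU10 HU) as Hmin.
  set (C := flow_const A r0 rho0 U10 U20) in *.
  set (m := m2 r0 U20) in *.
  assert (Hm1 : 0 < m1 r0 rho0 U10)
    by (unfold m1; repeat apply Rmult_lt_0_compat; lra).
  (* The level at [r0] is strictly above the minimal head, so by continuity the equation stays
     solvable slightly to the left. *)
  assert (Hleft : exists a, 0 < a < r0 /\ radial_head A (sqrt A) < head_level A C m a).
  { assert (Hc : continuous (head_level A C m) r0).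
    { apply (ex_derive_continuous (head_level A C m)). eexists.
      now apply is_derive_head_level. }
    destruct (Hc (fun y => radial_head A (sqrt A) < y)) as [e He].
    { apply (open_gt (radial_head A (sqrt A))). lra. }
    pose proof (cond_pos e) as Hepos.
    exists (r0 - Rmin e r0 / 2).
    assert (Hmn : 0 < Rmin e r0 / 2 /\ Rmin e r0 / 2 < e /\ Rmin e r0 / 2 < r0)
      by (unfold Rmin; destruct (Rle_dec e r0); lra).
    split; [lra|]. apply He.
    unfold ball. simpl. unfold AbsRing_ball, abs, minus, plus, opp. simpl.
    rewrite Rabs_left; lra. }
  destruct Hleft as [a [Ha Hlev]].
  destruct (radial_head_inverse A s (head_level A C m (r1 + 1)) HA Hs) as [G HG].
  set (u := fun x => G (head_level A C m x)).
  assert (Hu : forall x, a < x < r1 + 1 ->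
    0 < u x /\ 0 < s * (u x ^ 2 - A) /\ radial_head A (u x) = head_level A C m x /\
    is_derive u x ((m ^ 2 / x ^ 3 + A / x) / (u x - A / u x))).
  { intros x Hx. destruct (HG (head_level A C m x)) as [H1 [H2 [H3 H4]]].
    - split.
      + apply Rlt_trans with (1 := Hlev). apply head_level_increasing; lra.
      + apply head_level_increasing; lra.
    - repeat (split; [easy|]).
      apply (is_derive_comp G (head_level A C m) x); [easy|].
      apply is_derive_head_level. lra. }
  assert (Hne : forall x, a < x < r1 + 1 -> u x ^ 2 <> A).
  { intros x Hx Heq. destruct (Hu x Hx) as [_ [H _]]. rewrite Heq in H. lra. }
  assert (HuC : forall k, Ck k a (r1 + 1) u).
  { apply (radial_speed_Ck A C m); [lra|]. intros x Hx.
    destruct (Hu x Hx) as [H1 [_ [_ H4]]]. auto. }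
  (* Both values have the same head at [r0] and lie on the same branch. *)
  assert (Hu0 : u r0 = U10).
  { destruct (Hu r0) as [H1 [H2 [H3 _]]]; [lra|].
    apply (radial_head_inj A s); try easy. now rewrite H3. }
  (* Density and angular velocity are read off from the conserved mass flux and angular momentum. *)
  exists (Flow (fun x => m1 r0 rho0 U10 * / (x * u x)) u (fun x => m * / x)).
  unfold smooth_solution. cbn [density vrad vang].
  split; [|split; [|split]].
  - assert (Hsm : forall f, (forall k, Ck k a (r1 + 1) f) -> smooth_on r0 r1 f)
      by (intros f Hf; apply (Ck_smooth_on a (r1 + 1)); auto; lra).
    split; [|split]; apply Hsm; [|easy|]; intros k.
    + apply (Ck_mult k _ _ (fun _ => _) (fun x => / (x * u x))); [apply Ck_const|].
      apply Ck_inv.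
      * intros x Hx. destruct (Hu x Hx). apply Rmult_integral_contrapositive_currified; lra.
      * apply (Ck_mult k _ _ (fun x => x) u); [apply Ck_id | easy].
    + apply (Ck_mult k _ _ (fun _ => _) (fun x => / x)); [apply Ck_const|].
      apply (Ck_inv k _ _ (fun x => x)); [intros; lra | apply Ck_id].
  - intros r Hr. destruct (Hu r) as [H1 _]; [lra|].
    apply Rmult_lt_0_compat; [easy|].
    apply Rinv_0_lt_compat, Rmult_lt_0_compat; lra.
  - intros r Hr. destruct (Hu r) as [H1 [_ [_ H4]]]; [lra|].
    assert (Hner : u r ^ 2 <> A) by (apply Hne; lra).
    assert (Hexu : ex_derive u r) by (eexists; exact H4).
    pose proof (is_derive_unique _ _ _ H4) as Hdu.
    assert (Hprod : r * u r <> 0) by (apply Rmult_integral_contrapositive_currified; lra).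
    assert (Hdrho : is_derive (fun x => m1 r0 rho0 U10 * / (x * u x)) r
              (- m1 r0 rho0 U10 * (u r + r * Derive u r) / (r * u r) ^ 2)).
    { auto_derive; [now repeat split|].
      change (Derive (fun y => u y) r) with (Derive u r). field. lra. }
    assert (Hdv : is_derive (fun x => m * / x) r (- m / r ^ 2)).
    { auto_derive; [lra|]. field. lra. }
    rewrite (Derive_mult (fun x => m1 r0 rho0 U10 * / (x * u x)) u)
      by (try (eexists; exact Hdrho); easy).
    assert (Erho : Derive (fun x => m1 r0 rho0 U10 * / (x * u x)) r = _)
      by exact (is_derive_unique _ _ _ Hdrho).
    assert (Ev : Derive (fun x => m * / x) r = _)
      by exact (is_derive_unique _ _ _ Hdv).
    rewrite Erho, Ev, Hdu.
    assert (u r * u r - A <> 0) by (intros Hz; apply Hner; simpl; lra).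
    split; [|split]; field; repeat split; lra.
  - rewrite Hu0. unfold m, m1, m2. repeat split; field; lra.
Qed.

(** Smooth solutions are already unique, so each regime [P] reduces to showing that every smooth
    solution is in it. *)
Lemma exists_unique_smooth_solution (A r0 r1 rho0 U10 U20 : R) (P : flow -> Prop) :
  0 < A -> 0 < r0 -> r0 < r1 -> 0 < rho0 -> 0 < U10 -> U10 ^ 2 <> A ->
  (forall w, smooth_solution A r0 r1 rho0 U10 U20 w -> P w) ->
  exists_unique_flow r0 r1 (fun w => smooth_solution A r0 r1 rho0 U10 U20 w /\ P w).
Proof.
  intros HA Hr0 Hr01 Hrho0 HU10 HU HP.
  destruct (smooth_solution_exists A r0 r1 rho0 U10 U20) as [w Hw]; try easy.
  exists w. split; [auto|]. intros w' [Hw' _].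
  now apply (smooth_solution_unique A r0 r1 rho0 U10 U20).
Qed.

(** * Mach number criteria and the sonic radius *)

Lemma mach_sq_plus (A u v : R) : mach_sq A u + mach_sq A v = (u ^ 2 + v ^ 2) / A.
Proof. unfold mach_sq, Rdiv. ring. Qed.

Lemma mach_sq_gt1 (A u v : R) :
  0 < A -> 1 < mach_sq A u + mach_sq A v <-> A < u ^ 2 + v ^ 2.
Proof. intros HA. rewrite mach_sq_plus, <- Rlt_div_r by easy. now rewrite Rmult_1_l. Qed.

Lemma mach_sq_lt1 (A u v : R) :
  0 < A -> mach_sq A u + mach_sq A v < 1 <-> u ^ 2 + v ^ 2 < A.
Proof. intros HA. rewrite mach_sq_plus, Rlt_div_l by easy. now rewrite Rmult_1_l. Qed.

(** Padding with a zero component lets the two-component criteria serve for the radial Mach number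
    alone. *)
Lemma radial_mach_sq (A u : R) : mach_sq A u = mach_sq A u + mach_sq A 0.
Proof. unfold mach_sq, Rdiv. ring. Qed.

(* At density [rho_s] Bernoulli's law forces speed [sqrt A]; [r_s] is the
   radius at which the two momentum laws are compatible with this. *)
Lemma sonic_state (A r0 rho0 U10 U20 : R) :
  0 < A -> 0 < r0 -> 0 < rho0 -> 0 < U10 -> U20 <> 0 ->
  let rs := r_s A r0 rho0 U10 U20 in
  0 < rs /\
  exists us, 0 < us /\ us ^ 2 < A /\ us ^ 2 + (m2 r0 U20 / rs) ^ 2 = A /\
    radial_head A us =
      head_level A (flow_const A r0 rho0 U10 U20) (m2 r0 U20) rs.
Proof.
  intros HA Hr0 Hrho0 HU10 HU20 rs.
  set (q := rho_s A rho0 U10 U20).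
  assert (Hm1 : 0 < m1 r0 rho0 U10)
    by (unfold m1; repeat apply Rmult_lt_0_compat; lra).
  assert (Hm2 : m2 r0 U20 <> 0)
    by (unfold m2; apply Rmult_integral_contrapositive_currified; lra).
  assert (Hq : 0 < q) by apply exp_pos.
  assert (Hlnq : B0 A rho0 U10 U20 - A * ln q = A / 2).
  { unfold q, rho_s. rewrite ln_exp. field. lra. }
  assert (Hnum : 0 < m1 r0 rho0 U10 ^ 2 + m2 r0 U20 ^ 2 * q ^ 2).
  { rewrite <- Rpow_mult_distr.
    apply Rplus_lt_le_0_compat; [now apply pow_lt | apply pow2_ge_0]. }
  set (X := (m1 r0 rho0 U10 ^ 2 + m2 r0 U20 ^ 2 * q ^ 2) / (A * q ^ 2)).
  assert (HX : 0 < X).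
  { apply Rdiv_lt_0_compat; [easy|].
    apply Rmult_lt_0_compat; [easy | now apply pow_lt]. }
  assert (Hrs : rs = sqrt X).
  { unfold rs, r_s. fold q. rewrite Hlnq. unfold X. do 2 f_equal. field. }
  assert (Hrs0 : 0 < rs) by (rewrite Hrs; now apply sqrt_lt_R0).
  assert (Hrs2 : rs ^ 2 = X) by (rewrite Hrs; apply pow2_sqrt; lra).
  split; [easy|].
  assert (Hsum : (m1 r0 rho0 U10 / (rs * q)) ^ 2 + (m2 r0 U20 / rs) ^ 2 = A).
  { replace ((m1 r0 rho0 U10 / (rs * q)) ^ 2 + (m2 r0 U20 / rs) ^ 2)
      with ((m1 r0 rho0 U10 ^ 2 + m2 r0 U20 ^ 2 * q ^ 2) / (rs ^ 2 * q ^ 2))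
      by (field; lra).
    rewrite Hrs2. unfold X. field.
    repeat split; lra. }
  (* This is the radial speed that the mass flux imposes at radius [rs] and density [q]. *)
  exists (m1 r0 rho0 U10 / (rs * q)).
  assert (Hrsq : 0 < rs * q) by now apply Rmult_lt_0_compat.
  split; [now apply Rdiv_lt_0_compat|]. split; [|split; [easy|]].
  (* As [U20 <> 0], the angular part is positive, which puts the sonic state strictly below [sqrt A]
     in radial speed. *)
  - assert (0 < (m2 r0 U20 / rs) ^ 2).
    { apply pow2_gt_0. apply Rmult_integral_contrapositive_currified; [easy|].
      apply Rinv_neq_0_compat. lra. }
    lra.
  - unfold radial_head, head_level, flow_const.
    rewrite ln_div, ln_mult by easy.
    replace (B0 A rho0 U10 U20) with (A / 2 + A * ln q) by lra.
    replace (m2 r0 U20 ^ 2 / (2 * rs ^ 2)) with ((m2 r0 U20 / rs) ^ 2 / 2)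
      by (field; lra).
    lra.
Qed.

(** * Classification by the incoming Mach numbers *)

Theorem theorem2p1 (A r0 r1 rho0 U10 U20 : R)
  (hA : 0 < A) (hr0 : 0 < r0) (hr1 : r0 < r1)
  (hrho0 : 0 < rho0) (hU10 : 0 < U10) :
  (1 < mach_sq A U10 ->
     exists_unique_flow r0 r1 (fun w =>
       smooth_solution A r0 r1 rho0 U10 U20 w /\ supersonic A r0 r1 w)) /\
  (mach_sq A U10 + mach_sq A U20 < 1 ->
     exists_unique_flow r0 r1 (fun w =>
       smooth_solution A r0 r1 rho0 U10 U20 w /\ subsonic A r0 r1 w)) /\
  (mach_sq A U10 + mach_sq A U20 > 1 /\ 1 > mach_sq A U10 ->
     let rs := r_s A r0 rho0 U10 U20 in
     rs > r0 /\
     (r1 > rs ->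
        exists_unique_flow r0 r1 (fun w =>
          smooth_solution A r0 r1 rho0 U10 U20 w /\ transonic A r0 r1 w)) /\
     (r1 < rs ->
        exists_unique_flow r0 r1 (fun w =>
          smooth_solution A r0 r1 rho0 U10 U20 w /\ supersonic A r0 r1 w)) /\
     (r1 = rs ->
        exists_unique_flow r0 r1 (fun w =>
          smooth_solution A r0 r1 rho0 U10 U20 w /\
          supersonic_sonic A r0 r1 w) /\
        (forall w,
          smooth_solution A r0 r1 rho0 U10 U20 w ->
          supersonic_sonic A r0 r1 w ->
          forall r, r0 <= r <= r1 -> (sonic_at A w r <-> r = rs)))).
Proof.
  pose proof (initial_head A r0 rho0 U10 U20 hr0 hrho0 hU10) as Hinit.
  assert (Hbranch : forall s, s = 1 \/ s = -1 -> 0 < s * (U10 ^ 2 - A) ->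
    forall w, smooth_solution A r0 r1 rho0 U10 U20 w ->
    forall r, r0 <= r <= r1 ->
      0 < vrad w r /\ 0 < s * (vrad w r ^ 2 - A) /\
      radial_head A (vrad w r) =
        head_level A (flow_const A r0 rho0 U10 U20) (m2 r0 U20) r /\
      vang w r = m2 r0 U20 / r).
  { intros s Hs HsU w Hw r Hr.
    destruct (smooth_solution_branch A r0 r1 rho0 U10 U20 s w) with (r := r)
      as [H1 [H2 H3]]; try easy.
    destruct (first_integrals A r0 r1 rho0 U10 U20 w) with (r := r)
      as [_ [H4 _]]; try easy.
    repeat (split; [easy|]). rewrite <- H4. field. lra. }
  split; [|split].
  - intros HM. rewrite radial_mach_sq in HM. apply mach_sq_gt1 in HM; [|easy].
    apply exists_unique_smooth_solution; try easy; [lra|].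
    intros w Hw r Hr. apply mach_sq_gt1; [easy|].
    destruct (Hbranch 1) with (w := w) (r := r) as [_ [H _]]; auto; [lra|lra|].
    pose proof (pow2_ge_0 (vang w r)). lra.
  - intros HM. apply mach_sq_lt1 in HM; [|easy].
    pose proof (pow2_ge_0 U20) as HU20.
    apply exists_unique_smooth_solution; try easy; [lra|].
    intros w Hw r Hr. apply mach_sq_lt1; [easy|].
    destruct (Hbranch (-1)) with (w := w) (r := r) as [H1 [H2 [H3 H4]]]; auto; [lra|lra|].
    rewrite H4. apply Rlt_trans with (2 := HM).
    replace U20 with (m2 r0 U20 / r0) at 2 by (unfold m2; field; lra).
    apply (speed_decreasing A (flow_const A r0 rho0 U10 U20) (m2 r0 U20) r0 r); lra.
  - intros [HM HM1] rs.
    apply mach_sq_gt1 in HM; [|easy].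
    apply Rgt_lt in HM1. rewrite radial_mach_sq in HM1.
    apply mach_sq_lt1 in HM1; [|easy].
    assert (HU20 : U20 <> 0) by (intros Hz; subst U20; lra).
    destruct (sonic_state A r0 rho0 U10 U20) as [Hrs0 [us [Hus0 [HusA [Hus HusF]]]]];
      try easy. fold rs in Hrs0, Hus, HusF.
    (* The incoming flow is supersonic: [rs < r0] would make it subsonic by decrease of the speed,
       and [rs = r0] would make it sonic by injectivity on the branch. *)
    assert (Hrs : rs > r0).
    { assert (Hv0 : m2 r0 U20 / r0 = U20) by (unfold m2; field; lra).
      destruct (Rtotal_order rs r0) as [Hlt|[Heq|Hgt]]; [| |easy]; exfalso.
      - pose proof (speed_decreasing A (flow_const A r0 rho0 U10 U20) (m2 r0 U20)
                      rs r0 us U10) as Hsp.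
        rewrite Hv0 in Hsp. lra.
      - rewrite Heq in Hus, HusF. rewrite Hv0 in Hus.
        assert (us = U10) by (apply (radial_head_inj A (-1)); auto; lra).
        subst us. lra. }
    (* The comparison is with the state [us] on the solution curve of the scalar equation, so it
       also covers [rs] beyond [r1]. *)
    assert (Hmach : forall w, smooth_solution A r0 r1 rho0 U10 U20 w ->
      forall r, r0 <= r <= r1 ->
        (r < rs -> 1 < total_mach_sq A w r) /\
        (r = rs -> total_mach_sq A w r = 1) /\
        (rs < r -> total_mach_sq A w r < 1)).
    { intros w Hw r Hr.
      destruct (Hbranch (-1)) with (w := w) (r := r) as [H1 [H2 [H3 H4]]]; auto; [lra|].
      unfold total_mach_sq. rewrite H4. split; [|split]; intros Hrr.
      - apply mach_sq_gt1; [easy|]. rewrite <- Hus.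
        apply (speed_decreasing A (flow_const A r0 rho0 U10 U20)); lra.
      - subst r. rewrite mach_sq_plus.
        replace (vrad w rs) with us
          by (apply (radial_head_inj A (-1)); auto; lra).
        rewrite Hus. field. lra.
      - apply mach_sq_lt1; [easy|]. rewrite <- Hus.
        apply (speed_decreasing A (flow_const A r0 rho0 U10 U20)); lra. }
    split; [easy|]. split; [|split].
    + intros Hr1. apply exists_unique_smooth_solution; try easy; [lra|].
      intros w Hw. exists rs. split; [lra|]. split; [apply Hmach; auto; lra|].
      left. split; intros r Hr; apply Hmach; auto; lra.
    + intros Hr1. apply exists_unique_smooth_solution; try easy; [lra|].
      intros w Hw r Hr. apply Hmach; auto; lra.
    + intros Hr1. split.
      * apply exists_unique_smooth_solution; try easy; [lra|].
        intros w Hw. split.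
        -- intros r Hr. apply Hmach; auto; lra.
        -- apply Hmach; auto; lra.
      (* Before [rs] the flow is strictly supersonic, and [r <= r1 = rs] leaves only [r = rs]. *)
      * intros w Hw _ r Hr. destruct (Hmach w Hw r Hr) as [Hsup [Hson _]].
        split; [|exact Hson]. unfold sonic_at. intros Hs.
        destruct (Rlt_dec r rs) as [Hlt|]; [specialize (Hsup Hlt)|]; lra.
Qed.
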